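(* Let $\mathcal{I}$ be an ideal on $\mathbb{N}$. If there exists an $\omega$-partition $\{P_n:n\in\mathbb{N}\}$ of $\mathbb{N}$ with respect to $\mathcal{I}$, then there is a rich abstract upper density $\delta$ with $\mathcal{Z}_\delta=\mathcal{I}$.
   Context: An abstract upper density on $\mathbb{N}$ is a function $\delta:\mathcal{P}(\mathbb{N})\to[0,1]$ such that $\delta(\mathbb{N})=1$; $\delta(F)=0$ for every finite $F\subseteq\mathbb{N}$; $A\subseteq B$ implies $\delta(A)\le\delta(B)$; and $\delta(A\cup B)\le\delta(A)+\delta(B)$. It is rich if for every $r\in[0,1]$ there is $A\subseteq\mathbb{N}$ with $\delta(A)=r$. $\mathcal{Z}_\delta=\{A\subseteq\mathbb{N}:\delta(A)=0\}$. An ideal on $\mathbb{N}$ is a family $\mathcal{I}\subseteq\mathcal{P}(\mathbb{N})$ closed under finite unions and subsets, containing all finite subsets of $\mathbb{N}$, with $\mathbb{N}\notin\mathcal{I}$. A partition $\{P_n:n\in\mathbb{N}\}$ of $\mathbb{N}$ is an $\omega$-partition of $\mathbb{N}$ with respect to $\mathcal{I}$ if $P_n\notin\mathcal{I}$ for all $n$, and for every $A\subseteq\mathbb{N}$, if $A\cap P_n\in\mathcal{I}$ for every $n\in\mathbb{N}$ then $A\in\mathcal{I}$. *)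

(* Defs.v *)
From mathcomp Require Import all_boot all_order all_algebra.
From mathcomp Require Import boolp classical_sets functions cardinality reals.

Set Implicit Arguments.
Unset Strict Implicit.
Unset Printing Implicit Defensive.

Import Order.TTheory GRing.Theory Num.Theory.

Local Open Scope classical_set_scope.
Local Open Scope ring_scope.

Record is_ideal (I : set (set nat)) : Prop := IsIdeal {
  ideal_setU : forall A B, I A -> I B -> I (A `|` B);
  ideal_subset : forall A B, A `<=` B -> I B -> I A;
  ideal_finite : forall F, finite_set F -> I F;
  ideal_proper : ~ I [set: nat] }.

Record omega_partition (I : set (set nat)) (P : nat -> set nat) : Prop :=
  OmegaPartition {
    omega_partition_partition : partition [set: nat] P [set: nat];
    omega_partition_positive : forall n, ~ I (P n);
    omega_partition_glue :
      forall A, (forall n, I (A `&` P n)) -> I A }.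

Record upper_density (R : realType) (delta : set nat -> R) : Prop :=
  UpperDensity {
    upper_density_itv : forall A, 0 <= delta A <= 1;
    upper_density_setT : delta [set: nat] = 1;
    upper_density_finite : forall F, finite_set F -> delta F = 0;
    upper_density_le : forall A B, A `<=` B -> delta A <= delta B;
    upper_density_setU :
      forall A B, delta (A `|` B) <= delta A + delta B }.

Definition rich (R : realType) (delta : set nat -> R) : Prop :=
  forall r : R, 0 <= r <= 1 -> exists A, delta A = r.

Definition zero_sets (R : realType) (delta : set nat -> R) : set (set nat) :=
  [set A | delta A = 0].

(* Main.v *)
Require Import Defs.
From mathcomp Require Import all_boot all_order all_algebra.
From mathcomp Require Import boolp classical_sets functions cardinality reals.
From mathcomp Require Import lra.

(** Weigh the pieces of the partition by [2^-(n+1)] and let [delta A] be the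
    total weight of the pieces [P n] on which [A] is not small, i.e.
    [A `&` P n] is not in [I]. The set of these indices commutes with unions and
    is empty exactly when [A] is in [I], by the gluing property. Unions of pieces
    realise every set of indices, so richness is the existence of binary
    expansions in [[0, 1]]. *)

Set Implicit Arguments.
Unset Strict Implicit.
Unset Printing Implicit Defensive.

Import Order.TTheory GRing.Theory Num.Theory.

Local Open Scope classical_set_scope.
Local Open Scope ring_scope.

Section BinaryWeight.
Variable R : realType.
Implicit Types (J K : pred nat) (n k : nat) (r : R).

Definition binary_psum J n : R := \sum_(k < n) (J k)%:R * 2^-1 ^+ k.+1.

(** A supremum in place of a limit: the terms are nonnegative, so this is the sum of the series, and
    upper bounds need only be checked on partial sums. *)
Definition binary_weight J : R := sup (range (binary_psum J)).

Lemma binary_psumS J n :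
  binary_psum J n.+1 = binary_psum J n + (J n)%:R * 2^-1 ^+ n.+1.
Proof. by rewrite /binary_psum big_ord_recr. Qed.

Lemma half_exp_gt0 n : 0 < 2^-1 ^+ n :> R.
Proof. by rewrite exprn_gt0// invr_gt0. Qed.

Lemma half_expS n : 2^-1 ^+ n = 2^-1 ^+ n.+1 + 2^-1 ^+ n.+1 :> R.
Proof. rewrite exprS; lra. Qed.

Lemma half_exp_lt r : 0 < r -> exists n, 2^-1 ^+ n < r.
Proof.
(* Any natural number [b] above [r^-1] works, since [b < 2 ^ b]. *)
move=> r0; exists (Num.bound r^-1).
rewrite exprVn invf_plt ?posrE ?exprn_gt0//.
have /lt_trans : r^-1 < (Num.bound r^-1)%:R.
  by rewrite archi_boundP// invr_ge0 ltW.
by apply; rewrite -natrX ltr_nat ltn_expl.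
Qed.

(** The slack [2^-1 ^+ n] is the total weight of the digits still to come; each new digit uses at
    most half of it, so the induction passes. *)
Lemma binary_psum_le1 J n : binary_psum J n <= 1 - 2^-1 ^+ n.
Proof.
elim: n => [|n IHn]; first by rewrite /binary_psum big_ord0 expr0 subrr.
rewrite binary_psumS; have := half_exp_gt0 n.+1; move: IHn; rewrite (half_expS n).
by case: (J n); rewrite ?mul1r ?mul0r; lra.
Qed.

Lemma binary_weight_ge J n : binary_psum J n <= binary_weight J.
Proof.
apply: ub_le_sup; last by exists n.
exists 1 => _ [m _ <-]; have := binary_psum_le1 J m.
have := half_exp_gt0 m; lra.
Qed.

Lemma binary_weight_le J r :
  (forall n, binary_psum J n <= r) -> binary_weight J <= r.
Proof.
by move=> Jr; apply: ge_sup => [|_ [n _ <-]//]; exists (binary_psum J 0), 0%N.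
Qed.

Lemma binary_weight_ge0 J : 0 <= binary_weight J.
Proof. by apply: le_trans (binary_weight_ge J 0); rewrite /binary_psum big_ord0. Qed.

Lemma binary_weight_le1 J : binary_weight J <= 1.
Proof.
apply: binary_weight_le => n; have := binary_psum_le1 J n.
have := half_exp_gt0 n; lra.
Qed.

Lemma le_binary_weight J K : subpred J K -> binary_weight J <= binary_weight K.
Proof.
move=> JK; apply: binary_weight_le => n; apply: le_trans (binary_weight_ge K n).
apply: ler_sum => k _; rewrite ler_wpM2r ?(ltW (half_exp_gt0 _))// ler_nat.
by case: (J k) (JK k) => // ->.
Qed.

Lemma binary_weightU J K :
  binary_weight (predU J K) <= binary_weight J + binary_weight K.
Proof.
apply: binary_weight_le => n.
apply: le_trans (lerD (binary_weight_ge J n) (binary_weight_ge K n)).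
rewrite -big_split; apply: ler_sum => k _ /=.
rewrite -mulrDl ler_wpM2r ?(ltW (half_exp_gt0 _))// -natrD ler_nat.
by case: (J k); case: (K k).
Qed.

Lemma binary_weight_eq0 J : binary_weight J = 0 <-> forall k, ~~ J k.
Proof.
split=> [J0 k|J0].
  (* A single index [k] in [J] already puts [2^-1 ^+ k.+1] into the partial sum of length [k.+1]. *)
  apply/negP => Jk; have := binary_weight_ge J k.+1.
  rewrite J0 binary_psumS Jk mul1r.
  have : 0 <= binary_psum J k.
    by apply: sumr_ge0 => i _; rewrite mulr_ge0// ltW// half_exp_gt0.
  have := half_exp_gt0 k.+1; lra.
apply/eqP; rewrite eq_le binary_weight_ge0 andbT.
apply: binary_weight_le => n; apply: sumr_le0 => k _.
by rewrite (negbTE (J0 k)) mul0r.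
Qed.

(** What is left of [r] after [n] digits of the greedy expansion, which takes a weight whenever it
    still fits. *)
Fixpoint greedy_remainder r n : R :=
  if n is m.+1 then
    let t := greedy_remainder r m in
    t - (2^-1 ^+ m.+1 <= t)%R%:R * 2^-1 ^+ m.+1
  else r.

Definition greedy_digit r : pred nat :=
  fun n => 2^-1 ^+ n.+1 <= greedy_remainder r n.

(** Taking the weight [2^-1 ^+ n.+1] removes half of the bound [2^-1 ^+ n]; a weight that does not
    fit exceeds the remainder. *)
Lemma greedy_remainder_itv r n :
  0 <= r <= 1 -> 0 <= greedy_remainder r n <= 2^-1 ^+ n.
Proof.
move=> r01; elim: n => [|n IHn]; first by rewrite expr0.
rewrite [greedy_remainder _ _]/=; move: IHn; rewrite (half_expS n).
by case: (leP (2^-1 ^+ n.+1) (greedy_remainder r n)); rewrite ?mul1r ?mul0r; lra.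
Qed.

Lemma binary_psum_greedy r n :
  binary_psum (greedy_digit r) n = r - greedy_remainder r n.
Proof.
elim: n => [|n IHn]; first by rewrite /binary_psum big_ord0 subrr.
by rewrite binary_psumS IHn [greedy_remainder _ n.+1]/= /greedy_digit; lra.
Qed.

Lemma binary_weight_greedy r :
  0 <= r <= 1 -> binary_weight (greedy_digit r) = r.
Proof.
move=> r01; apply/eqP; rewrite eq_le; apply/andP; split.
  apply: binary_weight_le => n; rewrite binary_psum_greedy.
  have := greedy_remainder_itv n r01; lra.
(* If the weight fell short of [r], some [2^-1 ^+ n] would lie below the gap; but the gap is at most
   the remainder after [n] digits. *)
rewrite leNgt -subr_gt0; apply/negP => /half_exp_lt[n].
have := binary_weight_ge (greedy_digit r) n; rewrite binary_psum_greedy.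
have := greedy_remainder_itv n r01; lra.
Qed.

End BinaryWeight.

Definition positive_indices (I : set (set nat)) (P : nat -> set nat)
  (A : set nat) : pred nat := fun n => `[< ~ I (A `&` P n) >].

Section PositiveIndices.
Variables (I : set (set nat)) (P : nat -> set nat).
Hypotheses (hI : is_ideal I) (hP : omega_partition I P).
Local Notation pos := (positive_indices I P).

Lemma sub_positive_indices A B : A `<=` B -> subpred (pos A) (pos B).
Proof.
move=> AB n /asboolP IA; apply/asboolP => IB; apply: IA.
exact: (ideal_subset hI (setSI AB)).
Qed.

Lemma positive_indicesU A B : subpred (pos (A `|` B)) (predU (pos A) (pos B)).
Proof.
move=> n /asboolP IAB; rewrite /= -asbool_or; apply/asboolP.
apply: contrapT => /not_orP[/contrapT IA /contrapT IB]; apply: IAB.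
by rewrite setIUl; apply: ideal_setU.
Qed.

Lemma positive_indices_eq0 A : (forall n, ~~ pos A n) <-> I A.
Proof.
split=> [A0|IA n].
  apply: (omega_partition_glue hP) => n; apply: contrapT => IAn.
  by have /negP := A0 n; apply; apply/asboolP.
apply/negP => /asboolP; apply.
exact: (ideal_subset hI (@subIsetl _ _ _)).
Qed.

(** For [n] outside [J], disjointness makes the trace on [P n] empty, hence in [I]; for [n] in [J]
    the trace is all of [P n]. This turns digit sequences into sets. *)
Lemma positive_indices_bigcup (J : pred nat) :
  pos (\bigcup_(n in [set n | J n]) P n) = J.
Proof.
have [_ tP _] := omega_partition_partition hP.
apply/funext => n; apply/asboolP/idP => [In|Jn].
  apply: contrapT => NJn; apply: In; 
  apply: (ideal_subset hI) (ideal_finite hI (@finite_set0 _)).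
  move=> x [[m Jm Pmx] Pnx]; apply: NJn.
  by rewrite -(tP m n) //; exists x.
suff -> : (\bigcup_(m in [set m | J m]) P m) `&` P n = P n.
  exact: (omega_partition_positive hP).
by apply: setIidr; apply: bigcup_sup.
Qed.

End PositiveIndices.

Theorem theorem2p4 (R : realType) (I : set (set nat)) (hI : is_ideal I)
  (hP : exists P : nat -> set nat, omega_partition I P) :
  exists delta : set nat -> R,
    [/\ upper_density delta, rich delta & zero_sets delta = I].
Proof.
case: hP => P hP.
pose delta A : R := binary_weight R (positive_indices I P A).
have delta_rich : rich delta.
  move=> r r01; exists (\bigcup_(n in [set n | greedy_digit r n]) P n).
  by rewrite /delta positive_indices_bigcup// binary_weight_greedy.
have delta0 A : delta A = 0 <-> I A.
  by rewrite /delta binary_weight_eq0; exact: positive_indices_eq0.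
have delta_le A B : A `<=` B -> delta A <= delta B.
  by move=> AB; apply/le_binary_weight/sub_positive_indices.
exists delta; split=> //; last by apply/seteqP; split=> A /delta0.
split=> //.
- by move=> A; rewrite binary_weight_ge0 binary_weight_le1.
(* Richness already provides a set of density 1, and monotonicity passes this value on to the whole
   of [nat], so no geometric series is summed. *)
- have [|A A1] := delta_rich 1; first by rewrite ler01 lexx.
  by apply/eqP; rewrite eq_le binary_weight_le1 -A1 delta_le.
- by move=> F /(ideal_finite hI) /delta0.
- move=> A B; apply: le_trans (binary_weightU _ _ _).
  exact/le_binary_weight/positive_indicesU.
Qed.
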